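(* Let $C|R$ be a quadratic extension with $\operatorname{char}R\neq2$, let $H$ be the associated quaternion field, and let $g$ be the $\sigma$-hermitian form on $C^4$ and $h$ the $\alpha$-hermitian form on $H^3$ defined in the context. Then the groups $\mathrm{PEU}(C^4,g)$ and $\mathrm{PEU}(H^3,h)$ are isomorphic.
   Context: Setting. $R$ is a commutative field with $\operatorname{char}R\ne2$, $C|R$ is a quadratic field extension with $\mathrm{Gal}(C|R)$ of order two, generated by $\sigma\colon x\mapsto\overline{x}$, and $s\in R\smallsetminus\{0\}$ is such that the $\sigma$-hermitian form on $C^2$ with Gram matrix $\mathrm{diag}(1,s)$ is anisotropic (i.e. $a\overline{a}+sb\overline{b}\neq0$ for $(a,b)\neq(0,0)$). Let $H=\left\{\begin{pmatrix}a&x\\-s\overline{x}&\overline{a}\end{pmatrix} : a,x\in C\right\}$ (a quaternion field), $w=\begin{pmatrix}0&1\\-s&0\end{pmatrix}$, and embed $C$ in $H$ via $c\mapsto\mathrm{diag}(c,\overline{c})$. Then $H=C+wC$, with multiplication $(a+wb)(c+wd)=ac-s\overline{b}d+w(\overline{a}d+bc)$ for $a,b,c,d\in C$. The map $\alpha\colon H\to H\colon a+wb\mapsto\overline{a}+wb$ is an involutory anti-automorphism of $H$. Vector spaces are left vector spaces of rows. The forms are $g\colon C^4\times C^4\to C$, $g(x,y)=x_0y_3^\sigma+x_3y_0^\sigma+x_1y_1^\sigma+s\,x_2y_2^\sigma$ ($\sigma$-hermitian of Witt index $1$), and $h\colon H^3\times H^3\to H$, $h(X,Y)=X_0Y_2^\alpha+X_1Y_1^\alpha+X_2Y_0^\alpha$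 ($\alpha$-hermitian of Witt index $1$). For a non-degenerate hermitian form $f$ on $V$, $\mathrm{U}(V,f)$ is the group of all linear isometries of $f$, $\mathrm{EU}(V,f)$ is the subgroup of $\mathrm{U}(V,f)$ generated by all transvections contained in $\mathrm{U}(V,f)$, and $\mathrm{PEU}(V,f)$ is the group of collineations of the projective space of $V$ induced by $\mathrm{EU}(V,f)$. *)

(* Defs.v *)
From HB Require Import structures.
From mathcomp Require Import all_boot all_order all_algebra all_fingroup.
From mathcomp Require Import all_field.
From mathcomp Require Import boolp classical_sets functions.

Set Implicit Arguments.
Unset Strict Implicit.
Unset Printing Implicit Defensive.

Import GRing.Theory.
Local Open Scope classical_set_scope.
Local Open Scope ring_scope.

(* Groups of bijections of a (possibly infinite) type, as sets of functions. *)
Definition perm_group {T : Type} (G : set (T -> T)) : Prop :=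
  [/\ G idfun,
      forall a b, G a -> G b -> G (a \o b) &
      forall a, G a -> exists2 b, G b & cancel a b /\ cancel b a].

Definition group_isomorphic {S T : Type}
    (G : set (S -> S)) (K : set (T -> T)) : Prop :=
  exists2 F : (S -> S) -> (T -> T), set_bij G K F &
    forall a b, G a -> G b -> F (a \o b) = F a \o F b.

(* D is meant to be a skew field; it is only required to be a ring so that no
   division ring structure has to be declared on the type of quaternions. *)
Section Unitary.
Variables (D : nzRingType) (V : lmodType D).

Definition unitary (f : V -> V -> D) : set (V -> V) :=
  [set phi | [/\ linear phi, bijective phi &
                 forall x y, f (phi x) (phi y) = f x y]].

(* D^o is D as a left vector space over itself, so l is a linear form.  The
   identity is allowed (l = 0), which does not affect generated groups. *)
Definition transvection : set (V -> V) :=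
  [set tau | exists (l : {linear V -> D^o}) (u : V),
     l u = 0 /\ forall x, tau x = x + (l x : D) *: u].

Definition EU (f : V -> V -> D) : set (V -> V) :=
  smallest perm_group (transvection `&` unitary f).

(* The points of the projective space of V. *)
Definition point : Type :=
  {P : set V | exists2 v : V, v != 0 & P = [set c *: v | c in [set: D]]}.

Definition PEU (f : V -> V -> D) : set (point -> point) :=
  [set k | exists2 phi, EU f phi & forall P, sval (k P) = phi @` sval P].

End Unitary.

Section Quaternions.
Variables (R : fieldType) (C : splittingFieldType R).
Variables (s : R) (sigma : gal_of {:C}).

Definition quat_mx (a x : C) : 'M[C]_2 :=
  \matrix_(i < 2, j < 2)
    if i == 0 then (if j == 0 then a else x)
    else (if j == 0 then - (s%:A * sigma x) else sigma a).

(* The proof argument is not used here, but the ring structure of quat below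
   depends on it. *)
Definition quaternions of #[sigma]%g = 2%N : {pred 'M[C]_2} :=
  fun A => A == quat_mx (A 0 0) (A 0 1).

Lemma quat_mxP (A : 'M[C]_2) :
  reflect (A 1 0 = - (s%:A * sigma (A 0 1)) /\ A 1 1 = sigma (A 0 0))
          (A == quat_mx (A 0 0) (A 0 1)).
Proof.
apply: (iffP eqP) => [e|[e1 e2]].
  by split; rewrite [A in LHS]e mxE.
apply/matrixP => i j; rewrite mxE.
by case: i => [[|[|//]] hi]; case: j => [[|[|//]] hj] /=;
   rewrite -?e1 -?e2; congr (A _ _); apply/val_inj.
Qed.

Hypothesis sigma2 : #[sigma]%g = 2%N.

Lemma sigmaK : involutive sigma.
Proof.
move=> x; have := expg_order sigma; rewrite sigma2 expgS expg1 => e.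
by rewrite -(galM sigma sigma (memvf x)) e gal_id.
Qed.

Lemma quaternions_subring : subring_closed (quaternions sigma2).
Proof.
have ss : sigma s%:A = s%:A by rewrite linearZ /= rmorph1.
split.
- by apply/quat_mxP; rewrite !mxE /= (rmorph0 sigma) (rmorph1 sigma) mulr0 oppr0; split.
- move=> A B /quat_mxP[a1 a2] /quat_mxP[b1 b2]; apply/quat_mxP.
  by rewrite !mxE a1 a2 b1 b2 !rmorphB /= mulrBr opprB opprK addrC.
move=> A B /quat_mxP[a1 a2] /quat_mxP[b1 b2]; apply/quat_mxP.
rewrite !mxE !big_ord_recl !big_ord0 !addr0 /=.
have -> : lift ord0 ord0 = 1 :> 'I_2 by apply/val_inj.
rewrite a1 a2 b1 b2 !rmorphD !rmorphM !rmorphN /= !rmorphM /= !sigmaK ss.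
split; rewrite addrC; last by rewrite mulNr mulrN -mulrA mulrCA.
by rewrite mulrDr opprD mulNr mulrN -mulrA mulrCA.
Qed.

HB.instance Definition _ :=
  GRing.isSubringClosed.Build 'M[C]_2 (quaternions sigma2)
    quaternions_subring.

Record quat : Type := Quat {
  quat_val : 'M[C]_2;
  _ : quat_val \in quaternions sigma2 }.

HB.instance Definition _ := [isSub for quat_val].
HB.instance Definition _ := [Choice of quat by <:].
HB.instance Definition _ := [SubChoice_isSubNzRing of quat by <:].

Lemma quat_mx_in (a x : C) : quat_mx a x \in quaternions sigma2.
Proof. by apply/quat_mxP; rewrite !mxE. Qed.

Definition quat_of (a x : C) : quat := Quat (quat_mx_in a x).

Definition quat_emb (c : C) : quat := quat_of c 0.

Definition quat_w : quat := quat_of 0 1.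

(* The matrix of a + w b is quat_mx a (sigma b). *)
Definition quat_fst (X : quat) : C := quat_val X 0 0.
Definition quat_snd (X : quat) : C := sigma (quat_val X 0 1).

Lemma quat_decomp (X : quat) :
  X = quat_emb (quat_fst X) + quat_w * quat_emb (quat_snd X).
Proof.
apply/val_inj; case: X => A /= hA; rewrite /quat_fst /quat_snd /=.
have /eqP {1}-> : A == quat_mx (A 0 0) (A 0 1) by [].
apply/matrixP => i j; rewrite !mxE !big_ord_recl big_ord0 addr0 !mxE /=.
by case: i => [[|[|//]] hi]; case: j => [[|[|//]] hj] /=;
   rewrite ?rmorph0 ?rmorph1 ?sigmaK
           ?(mul0r, mulr0, mul1r, mulr1, oppr0, addr0, add0r, mulNr).
Qed.

Lemma quat_decomp_uniq (a b : C) (X : quat) :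
  X = quat_emb a + quat_w * quat_emb b -> quat_fst X = a /\ quat_snd X = b.
Proof.
move=> ->; rewrite /quat_fst /quat_snd /= !mxE !big_ord_recl !big_ord0 !mxE /=.
rewrite (rmorph0 sigma) ?(mul0r, mulr0, mul1r, mulr1, addr0, add0r, oppr0).
by rewrite sigmaK.
Qed.

Definition quat_alpha (X : quat) : quat :=
  quat_emb (sigma (quat_fst X)) + quat_w * quat_emb (quat_snd X).

Definition form_g (x y : 'rV[C]_4) : C :=
  x 0 0 * sigma (y 0 3) + x 0 3 * sigma (y 0 0)
  + x 0 1 * sigma (y 0 1) + s%:A * x 0 2 * sigma (y 0 2).

Definition form_h (X Y : 'rV[quat]_3) : quat :=
  X 0 0 * quat_alpha (Y 0 2) + X 0 1 * quat_alpha (Y 0 1)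
  + X 0 2 * quat_alpha (Y 0 0).

End Quaternions.

Arguments form_g {R C} s sigma x y.
Arguments form_h {R C} s {sigma} sigma2 X Y.

(* Main.v *)
From HB Require Import structures.
Require Import Defs.
From mathcomp Require Import all_boot all_order all_algebra all_fingroup.
From mathcomp Require Import all_field.
From mathcomp Require Import boolp classical_sets functions.
From mathcomp Require Import ring.

(** The isomorphism is a hermitian form of the Klein correspondence.  The
    exterior square of C^4 has dimension 6 over C; combining the form induced
    by g with the identification of the fourth exterior power with C gives a
    semilinear Hodge operator J on it, with J^2 = -s.  Letting w act as J turns
    the exterior square into a 3-dimensional vector space over H, on which the
    induced form and the wedge pairing together become the two C-components of
    h (up to sign).  In suitable coordinates this is the map [wedge] below from
    C^4 x C^4 to H^3.

    Call a permutation A of C^4 and a permutation B of H^3 compatible if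
    B (x ^ y) = A x ^ A y for all x and y.  Compatible pairs form a group, so
    it is enough to match generators and to match kernels.

    Generators: a unitary transvection is x |-> x + f(x, u) m u with u isotropic
    and m skew ([unitary_transvectionP]).  Both g and h have isotropic points
    with explicit normal forms, parametrized by the same affine quadric together
    with one point at infinity; an isotropic point <v> of C^4 corresponds to
    v ^ v^perp, which is a one-dimensional H-space of isotropic vectors.  The
    skew elements of H are the skew elements of C because 2 is invertible, and
    the transvections of C^4 and of H^3 at corresponding points with parameters
    m and -m are compatible, by an identity of polynomials ([wedge_affine],
    [wedge_infinity]).

    Kernels: for a compatible pair, A fixes every point if and only if B does
    ([wedge_homothety]).  A linear map fixing every point is a homothety with
    central ratio, the 2-vectors x ^ y span H^3, and x can be recovered up to a
    scalar from all the x ^ y with y in C^4.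

    Compatibility therefore induces a bijective homomorphism between the two
    groups of collineations ([PEU_isomorphic]). *)

Set Implicit Arguments.
Unset Strict Implicit.
Unset Printing Implicit Defensive.

Import GRing.Theory.
Local Open Scope ring_scope.

(** * Groups generated by unitary transvections *)

Lemma linear_smul (D : nzRingType) (V : lmodType D) (A : V -> V) c v :
  linear A -> A (c *: v) = c *: A v.
Proof.
move=> linA; have A0 : A 0 = 0.
  by have := linA (-1) 0 0; rewrite !scaleN1r !addNr.
by rewrite -[c *: v]addr0 linA A0 addr0.
Qed.

Lemma linear_inverse (D : nzRingType) (V : lmodType D) (A B : V -> V) :
  linear A -> cancel A B -> cancel B A -> linear B.
Proof.
by move=> linA AK BK a u v; rewrite -[LHS]AK -{1}[u]BK -{1}[v]BK -linA !AK.
Qed.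

Section Generated.
Context {D : nzRingType} {V : lmodType D} {f : V -> V -> D}.
Implicit Types (A B : V -> V).

Lemma unitary_perm_group : perm_group (unitary f).
Proof.
split=> [|A B [linA bijA isoA] [linB bijB isoB]|A [linA [B AK BK] isoA]].
- by split=> //; exists idfun.
- split; [|exact: bij_comp|by move=> x y /=; rewrite isoA isoB].
  by move=> a u v /=; rewrite linB linA.
- exists B => //; split; [exact: linear_inverse BK|by exists A|].
  by move=> x y; rewrite -isoA !BK.
Qed.

Lemma EU_unitary A : EU f A -> unitary f A.
Proof. by apply; split; [exact: unitary_perm_group|move=> B []]. Qed.

Lemma EU_transvection A : transvection A -> unitary f A -> EU f A.
Proof. by move=> tA uA P [_]; apply. Qed.

(** An intersection of permutation groups is closed under inverses because the
    inverse of a bijection is the same function in each of the groups. *)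
Lemma EU_perm_group : perm_group (EU f).
Proof.
split=> [P [] []//|A B EA EB P PP|A EA].
  by case: (PP) => -[_ + _] _; apply; [exact: EA|exact: EB].
have [_ [B AK BK] _] := EU_unitary EA.
exists B => // P PP; case: (PP) => -[_ _ /(_ A (EA _ PP)) [B' PB' [_ B'K]]] _.
suff -> : B = B' by [].
by apply: funext => x; rewrite -[x in LHS]B'K AK.
Qed.

Lemma EU_ind (P : set (V -> V)) :
  perm_group P -> (forall A, transvection A -> unitary f A -> P A) ->
  forall A, EU f A -> P A.
Proof. by move=> gP tP A; apply; split=> // B []; exact: tP. Qed.

End Generated.

(** * Collineations induced by linear bijections *)

Definition division (D : nzRingType) : Prop :=
  forall a : D, a != 0 -> exists2 b, b * a = 1 & a * b = 1.

Section Collineations.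
Context {D : nzRingType} {V : lmodType D}.
Implicit Types (A B : V -> V) (P Q : Defs.point V).

Definition line (v : V) (v0 : v != 0) : Defs.point V :=
  exist _ [set c *: v | c in [set: D]]%classic
    (ex_intro2 _ _ v v0 (erefl _)).

Lemma point_inj P Q : sval P = sval Q -> P = Q.
Proof.
case: P Q => [P hP] [Q hQ] /= e; subst Q.
by congr exist; exact: Prop_irrelevance.
Qed.

Definition induces A (k : Defs.point V -> Defs.point V) : Prop :=
  forall P, sval (k P) = [set A x | x in sval P]%classic.

Lemma induces_exists A : linear A -> injective A -> exists k, induces A k.
Proof.
move=> linA injA.
suff /choice[k hk] : forall P, exists Q,
    sval Q = [set A x | x in sval P]%classic by exists k.
move=> [P [v v0 Pv]] /=.
have A0 : A 0 = 0 by rewrite -[0 in LHS](scale0r 0) linear_smul // scale0r.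
have Av0 : A v != 0.
  by apply: contra v0 => /eqP Av; apply/eqP/injA; rewrite Av A0.
exists (line Av0) => /=.
rewrite Pv image_comp; apply/esym.
by apply: eq_imagel => c _ /=; exact: linear_smul.
Qed.

Lemma induces_comp A B k l :
  induces A k -> induces B l -> induces (A \o B) (k \o l).
Proof. by move=> h h' P; rewrite /= h h' image_comp. Qed.

Lemma same_collineationP A A' B k l : division D ->
  linear A -> linear B -> cancel A A' -> cancel A' A -> injective B ->
  induces A k -> induces B l ->
  k = l <-> forall v, exists c, (A' \o B) v = c *: v.
Proof.
move=> divD linA linB AK A'K injB Ak Bl.
have linA' := linear_inverse linA AK A'K.
split=> [kl v|h].
  have [->|v0] := eqVneq v 0.
    exists 0; rewrite scale0r /= -[0](scale0r 0).
    by rewrite (linear_smul _ _ linB) (linear_smul _ _ linA') !scale0r.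
  have := Bl (line v0); rewrite -kl Ak /= => e.
  have : [set B x | x in [set c *: v | c in [set: D]]]%classic (B v).
    by exists v => //; exists 1 => //; rewrite scale1r.
  by rewrite -e => -[_ [c _ <-] <-]; exists c; rewrite AK.
apply: funext => P; apply: point_inj; rewrite Ak Bl.
case: P => P [v v0 Pv] /=; rewrite {}Pv.
have [c hc] := h v.
have {hc} hc : B v = c *: A v by rewrite -linear_smul // -hc /= A'K.
have c0 : c != 0.
  apply: contra v0 => /eqP c0; apply/eqP/injB.
  by rewrite hc c0 scale0r -[0 in RHS](scale0r 0) linear_smul // scale0r.
have [d dc _] := divD c c0.
apply/seteqP; split=> _ [_ [a _ <-] <-].
  exists ((a * d) *: v); first by exists (a * d).
  by rewrite !linear_smul // hc scalerA -mulrA dc mulr1.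
exists ((a * c) *: v); first by exists (a * c).
by rewrite !linear_smul // hc scalerA.
Qed.

Lemma EU_induces (f : V -> V -> D) A :
  EU f A -> exists2 k, PEU f k & induces A k.
Proof.
move=> EA; have [linA /bij_inj injA _] := EU_unitary EA.
by have [k Ak] := induces_exists linA injA; exists k => //; exists A.
Qed.

End Collineations.

(** A linear map that fixes every point is a homothety.  Comparing its values at
    two basis vectors e_i, e_j and at e_i + y e_j shows that the ratio does not
    depend on the basis vector and commutes with y; this needs dimension at
    least 2. *)
Lemma pointwise_homothety (D : nzRingType) n
    (A : 'rV[D]_n.+2 -> 'rV[D]_n.+2) :
  linear A -> (forall v, exists c, A v = c *: v) ->
  exists c, (forall y, c * y = y * c) /\ forall x, A x = c *: x.
Proof.
move=> linA hA.
pose l : {linear 'rV[D]_n.+2 -> 'rV[D]_n.+2} := HB.pack A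
    (GRing.isLinear.Build _ _ _ _ _ linA).
have /choice[c hc] : forall i, exists c,
  A (delta_mx 0 i) = c *: delta_mx 0 i by move=> i.
have cy i j y : i != j -> c i * y = y * c j.
  move=> ij; have ji : j != i by rewrite eq_sym.
  have [d] := hA (y *: delta_mx 0 j + delta_mx 0 i).
  rewrite linA !hc => /rowP e.
  have := e j; have := e i; rewrite !mxE !eqxx /= (negbTE ij) (negbTE ji).
  by rewrite !(mulr0, mulr1, addr0, add0r) => -> ->.
have c0 i : c i = c 0.
  have [->//|i0] := eqVneq i 0.
  by have := cy i 0 1 i0; rewrite mul1r mulr1.
have cC y : c 0 * y = y * c 0 by have := cy 0 1 y isT; rewrite (c0 1).
exists (c 0); split=> // x.
rewrite {1}(row_sum_delta x) -[A]/(l : _ -> _) linear_sum; apply/rowP => i.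
rewrite summxE (bigD1 i) //= big1 => [|j ji].
  by rewrite linear_smul // hc c0 !mxE !eqxx /= mulr1 addr0 cC.
by rewrite linear_smul // hc !mxE eqxx eq_sym (negbTE ji) !mulr0.
Qed.

(** * Transfer of the groups along a relation *)

Section Transfer.
Context {D D' : nzRingType} {V : lmodType D} {V' : lmodType D'}.

(** This says that Q is a subgroup of the product of the groups of bijections of
    V and of V', as far as it consists of pairs of bijections. *)
Definition group_relation (Q : (V -> V) -> (V' -> V') -> Prop) : Prop :=
  [/\ Q idfun idfun,
      forall A1 A2 B1 B2, Q A1 B1 -> Q A2 B2 -> Q (A1 \o A2) (B1 \o B2) &
      forall A A' B B', Q A B -> cancel A A' -> cancel A' A ->
        cancel B B' -> cancel B' B -> Q A' B'].

Lemma EU_transfer (f : V -> V -> D) (f' : V' -> V' -> D') Q :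
  group_relation Q ->
  (forall A, transvection A -> unitary f A ->
     exists B, [/\ transvection B, unitary f' B & Q A B]) ->
  forall A, EU f A -> exists2 B, EU f' B & Q A B.
Proof.
move=> [Q_id Q_comp Q_inv] Q_transv A.
have [E1 EM EV] := @EU_perm_group _ _ f.
have [E1' EM' EV'] := @EU_perm_group _ _ f'.
suff : EU f A -> [set A | EU f A /\ exists2 B, EU f' B & Q A B]%classic A.
  by move=> h /h[].
move: A; apply: EU_ind => [|A tA uA].
  split=> [|A1 A2 [EA1 [B1 EB1 QB1]] [EA2 [B2 EB2 QB2]]|A [EA [B EB QB]]].
  - by split=> //; exists idfun.
  - by split; [exact: EM|exists (B1 \o B2); [exact: EM'|exact: Q_comp]].
  - have [A' EA' [AK A'K]] := EV _ EA; have [B' EB' [BK B'K]] := EV' _ EB.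
    by exists A' => //; split=> //; exists B' => //; exact: Q_inv QB _ _ _ _.
split; first exact: EU_transvection.
by have [B [tB uB QB]] := Q_transv A tA uA; exists B => //; exact: EU_transvection.
Qed.

End Transfer.

Lemma group_relation_flip (D D' : nzRingType) (V : lmodType D)
    (V' : lmodType D') (Q : (V -> V) -> (V' -> V') -> Prop) :
  group_relation Q -> group_relation (fun B A => Q A B).
Proof.
case=> Q_id Q_comp Q_inv; split=> // [A1 A2 B1 B2|A A' B B'].
  exact: Q_comp.
by move=> QBA AK A'K BK B'K; exact: Q_inv QBA _ _ _ _.
Qed.

Section Isomorphism.
Context {D D' : nzRingType} {V : lmodType D} {V' : lmodType D'}.
Context {f : V -> V -> D} {f' : V' -> V' -> D'}.
Variable Q : (V -> V) -> (V' -> V') -> Prop.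
Hypotheses (divD : division D) (divD' : division D').
Hypothesis Q_group : group_relation Q.
Hypothesis Q_transv : forall A, transvection A -> unitary f A ->
  exists B, [/\ transvection B, unitary f' B & Q A B].
Hypothesis Q_transv' : forall B, transvection B -> unitary f' B ->
  exists A, [/\ transvection A, unitary f A & Q A B].
Hypothesis Q_homothety : forall A B,
  linear A -> injective A -> linear B -> injective B -> Q A B ->
  (forall v, exists c, A v = c *: v) <-> (forall w, exists c, B w = c *: w).

(** The hypothesis on maps that fix all points is applied to the quotient of the
    two related pairs. *)
Lemma same_collineation_transfer A1 A2 B1 B2 k1 k2 l1 l2 :
  EU f A1 -> EU f A2 -> EU f' B1 -> EU f' B2 -> Q A1 B1 -> Q A2 B2 ->
  induces A1 k1 -> induces A2 k2 -> induces B1 l1 -> induces B2 l2 ->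
  k1 = k2 <-> l1 = l2.
Proof.
move=> EA1 EA2 EB1 EB2 Q1 Q2 Ak1 Ak2 Bl1 Bl2.
have [_ Q_comp Q_inv] := Q_group.
have [_ _ EV] := @EU_perm_group _ _ f.
have [_ _ EV'] := @EU_perm_group _ _ f'.
have [A' EA' [AK A'K]] := EV _ EA1; have [B' EB' [BK B'K]] := EV' _ EB1.
have [linA1 _ _] := EU_unitary EA1; have [linA' _ _] := EU_unitary EA'.
have [linA2 /bij_inj injA2 _] := EU_unitary EA2.
have [linB1 _ _] := EU_unitary EB1; have [linB' _ _] := EU_unitary EB'.
have [linB2 /bij_inj injB2 _] := EU_unitary EB2.
rewrite (same_collineationP divD linA1 linA2 AK A'K injA2 Ak1 Ak2).
rewrite (same_collineationP divD' linB1 linB2 BK B'K injB2 Bl1 Bl2).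
apply: Q_homothety.
- by move=> a u v /=; rewrite linA2 linA'.
- exact: inj_comp (can_inj A'K) injA2.
- by move=> a u v /=; rewrite linB2 linB'.
- exact: inj_comp (can_inj B'K) injB2.
- exact: Q_comp (Q_inv _ _ _ _ Q1 AK A'K BK B'K) Q2.
Qed.

(** The isomorphism sends the collineation of A to that of any B related to A:
    [same_collineation_transfer] shows at once that this does not depend on the
    choices and that it is injective. *)
Lemma PEU_isomorphic : group_isomorphic (PEU f) (PEU f').
Proof.
have [_ Q_comp _] := Q_group.
pose rel k l := exists A B,
  [/\ EU f A, EU f' B, Q A B, induces A k & induces B l].
have /choice[F hF] : forall k, exists l, PEU f k -> rel k l.
  move=> k; have [[A EA Ak]|nk] := pselect (PEU f k); last by exists id.
  have [B EB QAB] := EU_transfer Q_group Q_transv EA.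
  have [l _ Bl] := EU_induces EB.
  by exists l => _; exists A, B.
exists F; first split.
- by move=> k /hF [A [B [_ EB _ _ Bl]]]; exists B.
- move=> k1 k2; rewrite !inE => /hF[A1 [B1 [EA1 EB1 Q1 i1 j1]]].
  move=> /hF[A2 [B2 [EA2 EB2 Q2 i2 j2]]].
  exact: (same_collineation_transfer EA1 EA2 EB1 EB2 Q1 Q2 i1 i2 j1 j2).2.
- move=> l [B EB Bl].
  have [A EA QAB] := EU_transfer (group_relation_flip Q_group) Q_transv' EB.
  have [k Pk Ak] := EU_induces EA.
  exists k => //; have [A2 [B2 [EA2 EB2 Q2 i2 j2]]] := hF _ Pk.
  exact: (same_collineation_transfer EA2 EA EB2 EB Q2 QAB i2 Ak j2 Bl).1.
- move=> k1 k2 Pk1 Pk2; have [A1 [B1 [EA1 EB1 Q1 i1 j1]]] := hF _ Pk1.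
  have [A2 [B2 [EA2 EB2 Q2 i2 j2]]] := hF _ Pk2.
  have [_ EM _] := @EU_perm_group _ _ f.
  have [_ EM' _] := @EU_perm_group _ _ f'.
  have EA := EM _ _ EA1 EA2; have EB := EM' _ _ EB1 EB2.
  have Pk : PEU f (k1 \o k2) by exists (A1 \o A2) => //; exact: induces_comp.
  have [A3 [B3 [EA3 EB3 Q3 i3 j3]]] := hF _ Pk.
  exact: (same_collineation_transfer EA3 EA EB3 EB Q3 (Q_comp _ _ _ _ Q1 Q2) i3
           (induces_comp i1 i2) j3 (induces_comp j1 j2)).1.
Qed.

End Isomorphism.

(** * Transvections of a hermitian form *)

Record nondeg_hermitian {D : nzRingType} {V : lmodType D}
    (theta : D -> D) (f : V -> V -> D) : Prop := {
  thetaD : {morph theta : a b / a + b};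
  thetaM : forall a b, theta (a * b) = theta b * theta a;
  thetaK : involutive theta;
  form_linear : forall y a u v, f (a *: u + v) y = a * f u y + f v y;
  form_theta : forall x y, f y x = theta (f x y);
  form_nondeg : forall u, (forall x, f x u = 0) -> u = 0 }.

Section Transvections.
Context {D : nzRingType} {V : lmodType D} {theta : D -> D} {f : V -> V -> D}.
Hypothesis herm : nondeg_hermitian theta f.

Definition herm_transvection (u : V) (m : D) : V -> V :=
  fun x => x + (f x u * m) *: u.

Lemma theta0 : theta 0 = 0.
Proof. by apply: (addrI (theta 0)); rewrite -(thetaD herm) !addr0. Qed.

Lemma thetaN a : theta (- a) = - theta a.
Proof. by apply: (addrI (theta a)); rewrite -(thetaD herm) !subrr theta0. Qed.

Lemma theta1 : theta 1 = 1.
Proof.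
rewrite -[theta 1]mul1r -{1}[1](thetaK herm) -(thetaM herm) mul1r.
exact: thetaK herm _.
Qed.

Lemma herm_Dl x y z : f (x + y) z = f x z + f y z.
Proof. by rewrite -[x]scale1r (form_linear herm) mul1r scale1r. Qed.

Lemma herm_Zl a x z : f (a *: x) z = a * f x z.
Proof.
rewrite -[a *: x]addr0 (form_linear herm) -[RHS]addr0; congr (_ + _).
by apply: (addrI (f 0 z)); rewrite -herm_Dl !addr0.
Qed.

Lemma herm_Dr x y z : f x (y + z) = f x y + f x z.
Proof.
by rewrite (form_theta herm) herm_Dl (thetaD herm) -!(form_theta herm).
Qed.

Lemma herm_Zr a x z : f x (a *: z) = f x z * theta a.
Proof.
by rewrite (form_theta herm) herm_Zl (thetaM herm) -(form_theta herm).
Qed.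

Lemma herm_transvectionZ c u m :
  herm_transvection (c *: u) m = herm_transvection u (theta c * m * c).
Proof.
by apply: funext => x; rewrite /herm_transvection herm_Zr scalerA !mulrA.
Qed.

Lemma skew_scale c m : theta m = - m ->
  theta (theta c * m * c) = - (theta c * m * c).
Proof.
by move=> tm; rewrite !(thetaM herm) tm (thetaK herm) mulNr mulrN mulrA.
Qed.

Lemma herm_transvection_unitary u m : f u u = 0 -> theta m = - m ->
  transvection (herm_transvection u m) /\ unitary f (herm_transvection u m).
Proof.
move=> uu tm.
have lin_l : linear (fun x => f x u * m : D^o).
  by move=> a x y; rewrite herm_Dl herm_Zl mulrDl -mulrA.
have lin_t : linear (herm_transvection u m).
  move=> a x y; rewrite /herm_transvection herm_Dl herm_Zl mulrDl -mulrA.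
  by rewrite scalerDl -scalerA scalerDr addrACA.
split.
  pose l : {linear V -> D^o} := HB.pack (fun x => f x u * m : D^o)
    (GRing.isLinear.Build _ _ _ _ _ lin_l).
  by exists l, u; split=> //; rewrite /l /= uu mul0r.
have tK n : cancel (herm_transvection u n) (herm_transvection u (- n)).
  move=> x; rewrite /herm_transvection herm_Dl herm_Zl uu mulr0 addr0.
  by rewrite mulrN scaleNr addrK.
split=> //.
  exists (herm_transvection u (- m)) => // x.
  by rewrite -[X in herm_transvection u X _]opprK tK.
move=> x y; rewrite /herm_transvection herm_Dl !herm_Dr !herm_Zl !herm_Zr uu.
rewrite !mul0r mulr0 addr0 (thetaM herm) tm -(form_theta herm).
by rewrite mulNr mulrN mulrA subrK.
Qed.

(** Expanding f (A x, A y) = f (x, y) for A x = x + l(x) u gives a relation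
    between l and f(-, u).  Evaluating it at y = u and at y = y0 with l(y0) = 1
    shows that u is isotropic and that l is a right multiple of f(-, u); then
    x = y = y0 forces the ratio to be skew. *)
Lemma unitary_transvectionP : division D -> forall A,
  transvection A -> unitary f A ->
  exists u m, [/\ f u u = 0, theta m = - m & A = herm_transvection u m].
Proof.
move=> divD A [l [u [lu hA]]] [linA _ isoA].
have triv : A = id -> exists u m,
    [/\ f u u = 0, theta m = - m & A = herm_transvection u m].
  move=> ->; exists 0, 0; split; first by rewrite -[0](scale0r 0) herm_Zl mul0r.
    by rewrite theta0 oppr0.
  by apply: funext => x; rewrite /herm_transvection mulr0 scale0r addr0.
have [u0|u0] := eqVneq u 0.
  by apply: triv; apply: funext => x; rewrite hA u0 scaler0 addr0.
have [[x0 lx0]|l0] := pselect (exists x, (l x : D) != 0); last first.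
  apply: triv; apply: funext => x; rewrite hA.
  have -> : (l x : D) = 0.
    by apply/eqP; apply: contrapT => /negP h; apply: l0; exists x.
  by rewrite scale0r addr0.
have [b bl _] := divD _ lx0; pose y0 := b *: x0.
have ly0 : (l y0 : D) = 1 by rewrite /y0 linearZ.
have iso x y :
    f x u * theta (l y) + (l x : D) * (f u y + f u u * theta (l y)) = 0.
  apply: (addrI (f x y)); rewrite addr0 -[RHS]isoA !hA.
  by rewrite herm_Dl !herm_Dr !herm_Zl !herm_Zr !mulrDr !mulrA !addrA.
have uu : f u u = 0.
  by have := iso y0 u; rewrite lu theta0 !mulr0 add0r addr0 ly0 mul1r.
have lE x : f x u + (l x : D) * f u y0 = 0.
  by have := iso x y0; rewrite uu mul0r addr0 ly0 theta1 mulr1.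
have fy0 : f u y0 != 0.
  apply/eqP => e; case/eqP: u0; apply: (form_nondeg herm) => x.
  by have := lE x; rewrite e mulr0 addr0.
have [n nf fn] := divD _ fy0.
have lxE x : (l x : D) = f x u * - n.
  rewrite -[LHS]mulr1 -fn mulrA -[_ * f u y0](addKr (f x u)) lE addr0.
  by rewrite mulrN mulNr.
exists u, (- n); split=> //; last by apply: funext => x; rewrite hA lxE.
have := lE y0; rewrite ly0 mul1r (form_theta herm) => e.
have tn : theta n = - n.
  have : n * (theta (f u y0) + f u y0) * theta n = 0 by rewrite e mulr0 mul0r.
  rewrite mulrDr mulrDl nf mul1r -mulrA -(thetaM herm) nf theta1.
  by rewrite mulr1 => /eqP; rewrite addrC addr_eq0 => /eqP.
by rewrite thetaN tn.
Qed.

End Transvections.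

(** * Rows with three and four entries *)

Section Rows.
Context {D : nzRingType}.

Definition row3 (a b c : D) : 'rV[D]_3 := \row_i [:: a; b; c]`_i.
Definition row4 (a b c d : D) : 'rV[D]_4 := \row_i [:: a; b; c; d]`_i.

Lemma row3E a b c :
  ((row3 a b c 0 0 = a) * (row3 a b c 0 1 = b) * (row3 a b c 0 2 = c))%type.
Proof. by rewrite !mxE. Qed.

Lemma row4E a b c d :
  ((row4 a b c d 0 0 = a) * (row4 a b c d 0 1 = b) *
   (row4 a b c d 0 2 = c) * (row4 a b c d 0 3 = d))%type.
Proof. by rewrite !mxE. Qed.

Lemma row3P (x : 'rV[D]_3) : x = row3 (x 0 0) (x 0 1) (x 0 2).
Proof.
apply/rowP => -[[|[|[|//]]] h]; rewrite mxE /=;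
by congr (x _ _); apply/val_inj.
Qed.

Lemma row4P (x : 'rV[D]_4) : x = row4 (x 0 0) (x 0 1) (x 0 2) (x 0 3).
Proof.
apply/rowP => -[[|[|[|[|//]]]] h]; rewrite mxE /=;
by congr (x _ _); apply/val_inj.
Qed.

Lemma row3D a b c a' b' c' :
  row3 a b c + row3 a' b' c' = row3 (a + a') (b + b') (c + c').
Proof. by rewrite [LHS]row3P !mxE. Qed.

Lemma row4D a b c d a' b' c' d' :
  row4 a b c d + row4 a' b' c' d' = row4 (a + a') (b + b') (c + c') (d + d').
Proof. by rewrite [LHS]row4P !mxE. Qed.

Lemma row3Z k a b c : k *: row3 a b c = row3 (k * a) (k * b) (k * c).
Proof. by rewrite [LHS]row3P !mxE. Qed.

Lemma row4Z k a b c d :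
  k *: row4 a b c d = row4 (k * a) (k * b) (k * c) (k * d).
Proof. by rewrite [LHS]row4P !mxE. Qed.

End Rows.

Lemma ord4_ind (P : 'I_4 -> Prop) : P 0 -> P 1 -> P 2 -> P 3 -> forall i, P i.
Proof.
move=> p0 p1 p2 p3 [[|[|[|[|//]]]] hi].
- by rewrite (_ : Ordinal hi = 0) //; apply/val_inj.
- by rewrite (_ : Ordinal hi = 1) //; apply/val_inj.
- by rewrite (_ : Ordinal hi = 2) //; apply/val_inj.
- by rewrite (_ : Ordinal hi = 3) //; apply/val_inj.
Qed.

(** * Quaternions in coordinates *)

Section Quaternions.
Context {R : fieldType} {C : splittingFieldType R} {s : R} {sigma : gal_of {:C}}.
Context {sigma2 : #[sigma]%g = 2%N}.

(** [q a x] is a + x w.  Placing w on the right makes both coordinates linear for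
    the left action of C, unlike those of a + w b, where b is the conjugate
    of x. *)
Local Notation q := (@quat_of R C s sigma sigma2).
Local Notation H := (quat s sigma2).

Lemma sigmaD (x y : C) : sigma (x + y) = sigma x + sigma y.
Proof. exact: rmorphD. Qed.

Lemma sigmaM (x y : C) : sigma (x * y) = sigma x * sigma y.
Proof. exact: rmorphM. Qed.

Lemma sigmaN (x : C) : sigma (- x) = - sigma x.
Proof. exact: rmorphN. Qed.

Lemma sigma_alg : sigma s%:A = s%:A.
Proof. by rewrite linearZ /= rmorph1. Qed.

Lemma sigma0 : sigma 0 = 0. Proof. exact: rmorph0. Qed.
Lemma sigma1 : sigma 1 = 1. Proof. exact: rmorph1. Qed.

Definition sigmaE :=
  (sigmaD, sigmaM, sigmaN, sigma_alg, sigma0, sigma1, sigmaK sigma2).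

Lemma quatP (X : H) : exists a x, X = q a x.
Proof.
by case: X => A hA; exists (A 0 0), (A 0 1); apply/val_inj => /=; exact/eqP.
Qed.

Lemma quat_of_inj a x b y : q a x = q b y -> a = b /\ x = y.
Proof.
move/(congr1 (@quat_val _ _ _ _ _))/matrixP => e.
by have := e 0 0; have := e 0 1; rewrite !mxE.
Qed.

Lemma quat_of0 : q 0 0 = 0.
Proof.
apply/val_inj/matrixP => i j; rewrite !mxE /= sigma0 mulr0 oppr0.
by do 2!case: ifP.
Qed.

Lemma quat_of1 : q 1 0 = 1.
Proof.
apply/val_inj/matrixP => i j; rewrite !mxE /= sigma0 mulr0 oppr0 sigma1.
by case: i => [[|[|//]] hi]; case: j => [[|[|//]] hj].
Qed.

Lemma quat_ofD a x b y : q a x + q b y = q (a + b) (x + y).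
Proof.
apply/val_inj/matrixP => i j; rewrite !mxE /= !sigmaE mulrDr opprD.
by do 2!case: ifP.
Qed.

Lemma quat_ofN a x : - q a x = q (- a) (- x).
Proof. by apply/eqP; rewrite eq_sym -addr_eq0 quat_ofD !addNr quat_of0. Qed.

Lemma quat_ofM a x b y :
  q a x * q b y = q (a * b - s%:A * x * sigma y) (a * y + x * sigma b).
Proof.
apply/val_inj/matrixP => i j.
rewrite !mxE !big_ord_recl !big_ord0 !mxE /= !sigmaE.
by case: i => [[|[|//]] hi]; case: j => [[|[|//]] hj] /=; ring.
Qed.

Lemma quat_alphaE a x : quat_alpha (q a x) = q (sigma a) x.
Proof.
rewrite /quat_alpha /quat_fst /quat_snd /quat_emb /quat_w /= !mxE /=.
by rewrite quat_ofM quat_ofD; congr quat_of; rewrite !sigmaE; ring.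
Qed.

Definition quatE := (quat_ofD, quat_ofN, quat_ofM, quat_alphaE).

Lemma sigma_moves : exists c : C, sigma c != c.
Proof.
apply: contrapT => n; have : sigma = 1%g.
  apply/eqP/gal_eqP => c _; rewrite gal_id; apply/eqP.
  by apply: contrapT => /negP cs; apply: n; exists c.
by move=> e; move: sigma2; rewrite e order1.
Qed.

Lemma quat_center (Q : H) :
  (forall X, Q * X = X * Q) -> exists c, Q = q c 0.
Proof.
have [a [x ->]] := quatP Q => hQ; exists a; congr quat_of.
have [c sc] := sigma_moves.
have := hQ (q c 0); rewrite !quatE => /quat_of_inj[_].
rewrite mulr0 mul0r add0r addr0 mulrC => /eqP.
rewrite -subr_eq0 -mulrBl mulf_eq0 subr_eq0.
by rewrite (negbTE sc) => /eqP.
Qed.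

Lemma two_neq0 : 2%N \notin [pchar R] -> (2%:R : C) != 0.
Proof.
by move=> h; rewrite -(rmorph_nat (in_alg C)) fmorph_eq0; move: h; rewrite inE.
Qed.

Lemma skew_quat (X : H) : 2%N \notin [pchar R] ->
  quat_alpha X = - X -> exists2 m, sigma m = - m & X = q m 0.
Proof.
move=> /two_neq0 two.
have [a [x ->]] := quatP X; rewrite quat_alphaE quat_ofN => /quat_of_inj[sa x0].
exists a => //; congr quat_of; apply: (mulfI two); rewrite mulr0 mulr_natl mulr2n.
by apply/eqP; rewrite addr_eq0 -x0.
Qed.

End Quaternions.

Lemma field_division (F : fieldType) : division F.
Proof. by move=> a a0; exists a^-1; rewrite ?mulVf ?mulfV. Qed.

(** * The two hermitian forms and their isotropic vectors *)

Section Forms.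
Context {R : fieldType} {C : splittingFieldType R} {s : R} {sigma : gal_of {:C}}.
Context {sigma2 : #[sigma]%g = 2%N}.
Hypothesis char_R : 2%N \notin [pchar R].
Hypothesis s_neq0 : s != 0.
Hypothesis anisotropic : forall a b : C, (a, b) <> (0, 0) ->
  a * sigma a + s%:A * b * sigma b != 0.

Local Notation H := (quat s sigma2).
Local Notation q := (@quat_of R C s sigma sigma2).
Local Notation alpha := (@quat_alpha R C s sigma sigma2).
Local Notation sigma_simp := (@sigmaE R C s sigma sigma2).
Local Notation g := (form_g s sigma).
Local Notation h := (form_h s sigma2).

Lemma quat_division : division H.
Proof.
move=> X; have [a [x ->]] := quatP X => n0.
have [N NE] : exists N, N = a * sigma a + s%:A * x * sigma x by eexists.
have N0 : N != 0.
  rewrite NE; apply: anisotropic => -[a0 x0].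
  by rewrite a0 x0 quat_of0 eqxx in n0.
have sN : sigma N = N by rewrite NE !sigma_simp; ring.
have sNV : sigma N^-1 = N^-1 by rewrite -[in RHS]sN; exact: fmorphV.
exists (q (sigma a / N) (- x / N)); rewrite quat_ofM -quat_of1; congr quat_of.
- by rewrite -[RHS](divff N0) [X in _ = X / _]NE; ring.
- by ring.
- by rewrite !sigma_simp sNV -[RHS](divff N0) [X in _ = X / _]NE; ring.
- by rewrite !sigma_simp sNV; ring.
Qed.

Lemma form_g_hermitian : nondeg_hermitian (fun c : C => sigma c) g.
Proof.
split.
- exact: sigmaD.
- by move=> a b; rewrite sigmaM mulrC.
- exact: sigmaK.
- by move=> y a u v; rewrite /form_g !mxE; ring.
- by move=> x y; rewrite /form_g !sigma_simp; ring.
move=> u hu; rewrite (row4P u).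
have t0 : (s%:A : C) != 0 by rewrite scaler_eq0 oner_eq0 orbF.
have su (c : C) : sigma c = 0 -> c = 0.
  by move/(congr1 sigma); rewrite !sigma_simp.
have := hu (row4 1 0 0 0); have := hu (row4 0 1 0 0).
have := hu (row4 0 0 1 0); have := hu (row4 0 0 0 1).
rewrite /form_g !row4E !(mul0r, mul1r, mulr0, add0r, addr0, mulr1).
move=> /su-> /eqP; rewrite mulf_eq0 (negbTE t0) /= => /eqP/su-> /su-> /su->.
by apply/rowP => -[[|[|[|[|//]]]] i]; rewrite !mxE.
Qed.

Lemma form_h_hermitian : nondeg_hermitian alpha h.
Proof.
have aD : {morph alpha : a b / a + b}.
  move=> X Y; have [a [x ->]] := quatP X; have [b [y ->]] := quatP Y.
  by rewrite !quatE !sigma_simp.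
have aM X Y : alpha (X * Y) = alpha Y * alpha X.
  have [a [x ->]] := quatP X; have [b [y ->]] := quatP Y.
  by rewrite !quatE !sigma_simp; congr quat_of; ring.
have aK : involutive alpha.
  by move=> X; have [a [x ->]] := quatP X; rewrite !quatE !sigma_simp.
split=> //.
- move=> y a u v; rewrite /form_h !mxE.
  move: (alpha _) (alpha _) (alpha _) => y2 y1 y0.
  rewrite !mulrDl !mulrDr !mulrA.
  by rewrite [RHS]addrACA [X in _ = X + _]addrACA.
- move=> x y; rewrite /form_h !aD !aM !aK.
  by rewrite [RHS]addrC [X in _ = _ + X]addrC addrA.
move=> u hu; rewrite (row3P u).
have a0 : alpha 0 = 0 by rewrite -quat_of0 !quatE !sigma_simp.
have su (c : H) : alpha c = 0 -> c = 0 by move/(congr1 alpha); rewrite aK a0.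
have := hu (row3 1 0 0); have := hu (row3 0 1 0); have := hu (row3 0 0 1).
rewrite /form_h !row3E !(mul0r, mul1r, mulr0, add0r, addr0, mulr1).
move=> /su-> /su-> /su->.
by apply/rowP => -[[|[|[|//]]] i]; rewrite !mxE.
Qed.

Definition on_affine_quadric (a b z : C) : Prop :=
  sigma z = - (z + a * sigma a + s%:A * b * sigma b).

Definition affine_g (a b z : C) : 'rV[C]_4 := row4 1 a b z.

(** For v = (1, a, b, z) isotropic, this is v ^ u, where u = (0, 1, 0, -a^sigma)
    is orthogonal to v; it spans v ^ v^perp over H. *)
Definition affine_h (a b z : C) : 'rV[H]_3 :=
  row3 1 (q (- sigma a) b) (q (- (a * sigma a) - z) (b * sigma a)).

Lemma form_g_affine a b z :
  g (affine_g a b z) (affine_g a b z) = 0 <-> on_affine_quadric a b z.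
Proof.
rewrite /form_g /affine_g !row4E sigma1 mulr1 mul1r /on_affine_quadric.
rewrite -!addrA; split=> [/eqP|->]; last by rewrite addNr.
by rewrite addr_eq0 => /eqP.
Qed.

Lemma form_h_affine a b z :
  on_affine_quadric a b z -> h (affine_h a b z) (affine_h a b z) = 0.
Proof.
move=> sz; rewrite /form_h /affine_h !row3E -quat_of1 !quatE -quat_of0.
by congr quat_of; rewrite !(sigma_simp, sz); ring.
Qed.

(** If the first coordinate is zero, the middle two form an isotropic vector of
    the plane with Gram matrix diag(1, s), so they are zero as well. *)
Lemma isotropic_g u : g u u = 0 ->
  (exists c, u = c *: row4 0 0 0 1) \/
  exists c a b z, on_affine_quadric a b z /\ u = c *: affine_g a b z.
Proof.
have [u0|u0] := eqVneq (u 0 0) 0 => uu.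
  left; exists (u 0 3).
  move: uu; rewrite /form_g u0 sigma0 mul0r mulr0 !add0r => uu.
  have [e1 e2] : (u 0 1, u 0 2) = (0, 0).
    by apply: contrapT => /anisotropic; rewrite uu eqxx.
  by rewrite row4Z !mulr0 mulr1 {1}(row4P u) u0 e1 e2.
right; exists (u 0 0), (u 0 1 / u 0 0), (u 0 2 / u 0 0), (u 0 3 / u 0 0).
have uE :
    u = u 0 0 *: affine_g (u 0 1 / u 0 0) (u 0 2 / u 0 0) (u 0 3 / u 0 0).
  by rewrite row4Z mulr1 ![u 0 0 * _]mulrC !divfK // -row4P.
split=> //; apply/form_g_affine; move: uu.
rewrite {1 2}uE (herm_Zl form_g_hermitian) (herm_Zr form_g_hermitian) => /eqP.
rewrite !mulf_eq0 (negbTE u0) /= => /orP[/eqP//|/eqP su].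
by case/eqP: u0; rewrite -[LHS](sigmaK sigma2) su sigma0.
Qed.

(** For (1, X, Z) isotropic with X = x + y w, the equation Z + Z^alpha =
    - X X^alpha determines the w-component of Z, since 2 is invertible, so that
    all such vectors have the form [affine_h]. *)
Lemma isotropic_h U : h U U = 0 ->
  (exists c, U = c *: row3 0 0 1) \/
  exists c a b z, on_affine_quadric a b z /\ U = c *: affine_h a b z.
Proof.
have hH := form_h_hermitian.
have [u0|u0] := eqVneq (U 0 0) 0 => UU.
  left; exists (U 0 2); rewrite row3Z !mulr0 mulr1.
  move: UU; rewrite /form_h u0 (theta0 hH) mul0r mulr0 add0r addr0 => UU.
  suff u1 : U 0 1 = 0 by rewrite {1}(row3P U) u0 u1.
  have [//|n1] := eqVneq (U 0 1) 0; have [d dU _] := quat_division n1.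
  have aU : alpha (U 0 1) = 0 by rewrite -[LHS]mul1r -dU -mulrA UU mulr0.
  by case/eqP: n1; rewrite -[LHS](thetaK hH) aU (theta0 hH).
right; have [d dU Ud] := quat_division u0.
have [x [y xy]] := quatP (d * U 0 1); have [p [r pr]] := quatP (d * U 0 2).
have UE : U = U 0 0 *: row3 1 (q x y) (q p r).
  by rewrite row3Z mulr1 -xy -pr !mulrA Ud !mul1r -row3P.
have : h (row3 1 (q x y) (q p r)) (row3 1 (q x y) (q p r)) = 0.
  move: UU; rewrite {1 2}UE (herm_Zl hH) (herm_Zr hH) => UU.
  have := congr1 (fun z => d * z * alpha d) UU; rewrite mulr0 mul0r.
  by rewrite !mulrA dU mul1r -mulrA -(thetaM hH) dU (theta1 hH) mulr1.
rewrite /form_h !row3E -quat_of1 !quatE -quat_of0 !sigma_simp.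
move=> /quat_of_inj[e1 e2].
exists (U 0 0), (- sigma x), y, (- (x * sigma x) - p); split.
  rewrite /on_affine_quadric !sigma_simp; apply/eqP.
  by rewrite -subr_eq0 -oppr_eq0; apply/eqP; rewrite -[RHS]e1; ring.
rewrite {1}UE /affine_h; congr (_ *: row3 _ _ _); congr quat_of.
- by rewrite !sigma_simp opprK.
- by rewrite !sigma_simp; ring.
apply: (mulfI (two_neq0 char_R)); apply/eqP; rewrite -subr_eq0; apply/eqP.
by rewrite -[RHS]e2 !sigma_simp; ring.
Qed.

End Forms.

(** * The exterior square of C^4 as a quaternionic space *)

Definition plucker {F : fieldType} (x y : 'rV[F]_4) (i j : 'I_4) : F :=
  x 0 i * y 0 j - x 0 j * y 0 i.

Section ExteriorSquare.
Context {R : fieldType} {C : splittingFieldType R} {s : R} {sigma : gal_of {:C}}.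
Context {sigma2 : #[sigma]%g = 2%N}.
Hypothesis char_R : 2%N \notin [pchar R].
Hypothesis s_neq0 : s != 0.
Hypothesis anisotropic : forall a b : C, (a, b) <> (0, 0) ->
  a * sigma a + s%:A * b * sigma b != 0.

Local Notation H := (quat s sigma2).
Local Notation q := (@quat_of R C s sigma sigma2).
Local Notation sigma_simp := (@sigmaE R C s sigma sigma2).
Local Notation g := (form_g s sigma).
Local Notation h := (form_h s sigma2).
Local Notation on_affine_quadric := (@on_affine_quadric R C s sigma).
Local Notation affine_h := (@affine_h R C s sigma sigma2).

(** The pairs of Plucker coordinates and their signs come from the Hodge operator
    J of g, for which J e01 = e02, J e03 = -e12 and J e13 = -e23: the vectors
    e01, e03 and e13 go to the standard basis of H^3, and w acts as J. *)
Definition wedge (x y : 'rV[C]_4) : 'rV[H]_3 :=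
  let p := plucker x y in
  row3 (q (p 0 1) (p 0 2)) (q (p 0 3) (- p 1 2)) (q (p 1 3) (- p 2 3)).

Definition wedge_compatible
    (A : 'rV[C]_4 -> 'rV[C]_4) (B : 'rV[H]_3 -> 'rV[H]_3) : Prop :=
  forall x y, B (wedge x y) = wedge (A x) (A y).

(** Applying the transvection with vector v and parameter m to x ^ y adds
    m v ^ (g(x, v) y - g(y, v) x).  The second factor is orthogonal to v, so the
    added term is a quaternion multiple of [affine_h]; the factor turns out to be
    - h(x ^ y, affine_h) m. *)
Lemma wedge_affine a b z m :
  on_affine_quadric a b z -> sigma m = - m ->
  wedge_compatible (herm_transvection (f:=g) (affine_g a b z) m)
                   (herm_transvection (f:=h) (affine_h a b z) (q (- m) 0)).
Proof.
move=> sz sm x y; rewrite (row4P x) (row4P y).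
move: (x 0 0) (x 0 1) (x 0 2) (x 0 3) (y 0 0) (y 0 1) (y 0 2) (y 0 3).
clear x y => x0 x1 x2 x3 y0 y1 y2 y3.
rewrite /herm_transvection /affine_g /affine_h /wedge /plucker /form_g /form_h.
rewrite -quat_of1 !row4E !row3E !quatE !row4Z !row4D !row4E !row3Z !quatE.
rewrite !row3D !quatE.
by congr row3; congr quat_of; rewrite !(sigma_simp, sz, sm); ring.
Qed.

Lemma wedge_infinity m : sigma m = - m ->
  wedge_compatible (herm_transvection (f:=g) (row4 0 0 0 1) m)
                   (herm_transvection (f:=h) (row3 0 0 1) (q (- m) 0)).
Proof.
move=> sm x y; rewrite (row4P x) (row4P y).
move: (x 0 0) (x 0 1) (x 0 2) (x 0 3) (y 0 0) (y 0 1) (y 0 2) (y 0 3).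
clear x y => x0 x1 x2 x3 y0 y1 y2 y3.
rewrite /herm_transvection /wedge /plucker /form_g /form_h.
rewrite -quat_of0 -quat_of1 !row4E !row3E !quatE !row4Z !row4D !row4E !row3Z.
rewrite !quatE !row3D !quatE.
by congr row3; congr quat_of; rewrite !(sigma_simp, sm); ring.
Qed.

Definition corresponding_points (v : 'rV[C]_4) (Y : 'rV[H]_3) : Prop :=
  [/\ g v v = 0, h Y Y = 0 & forall m, sigma m = - m ->
      wedge_compatible (herm_transvection (f:=g) v m)
                       (herm_transvection (f:=h) Y (q (- m) 0))].

Lemma corresponding_points_affine a b z : on_affine_quadric a b z ->
  corresponding_points (affine_g a b z) (affine_h a b z).
Proof.
move=> qz; split; [exact/form_g_affine|exact: form_h_affine|].
by move=> m sm; apply: wedge_affine.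
Qed.

Lemma corresponding_points_infinity :
  corresponding_points (row4 0 0 0 1) (row3 0 0 1).
Proof.
split; last by move=> m; apply: wedge_infinity.
  by rewrite /form_g !row4E sigma0 !(mul0r, mulr0, addr0).
by rewrite /form_h !row3E (theta0 form_h_hermitian) !(mul0r, mulr0, addr0).
Qed.

Lemma transvection_g_to_h A : transvection A -> unitary g A ->
  exists B, [/\ transvection B, unitary h B & wedge_compatible A B].
Proof.
have gH := form_g_hermitian (sigma2 := sigma2) s_neq0.
move=> tA uA.
have [u [m [uu tm ->]]] := unitary_transvectionP gH (@field_division C) tA uA.
have [c [v [Y [-> [vv YY vY]]]]] :
    exists c v Y, u = c *: v /\ corresponding_points v Y.
  have [[c ->]|] := isotropic_g (sigma2 := sigma2) s_neq0 anisotropic uu.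
    exists c, (row4 0 0 0 1), (row3 0 0 1); split=> //.
    exact: corresponding_points_infinity.
  case=> c [a [b [z [qz ->]]]].
  exists c, (affine_g a b z), (affine_h a b z); split=> //.
  exact: corresponding_points_affine.
rewrite (herm_transvectionZ gH); have sm := skew_scale gH c tm.
exists (herm_transvection (f:=h) Y (q (- (sigma c * m * c)) 0)).
have [] := herm_transvection_unitary form_h_hermitian
  (u := Y) (m := q (- (sigma c * m * c)) 0) => //.
  by rewrite !quatE oppr0; congr quat_of; rewrite sigmaN sm.
by move=> tB uB; split=> //; exact: vY.
Qed.

Lemma transvection_h_to_g B : transvection B -> unitary h B ->
  exists A, [/\ transvection A, unitary g A & wedge_compatible A B].
Proof.
have gH := form_g_hermitian (sigma2 := sigma2) s_neq0.
have hH := form_h_hermitian (s := s) (sigma2 := sigma2).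
move=> tB uB; have [U [m [UU tm ->]]] :=
  unitary_transvectionP hH (quat_division anisotropic) tB uB.
have [c [v [Y [-> [vv YY vY]]]]] :
    exists c v Y, U = c *: Y /\ corresponding_points v Y.
  have [[c ->]|[c [a [b [z [qz ->]]]]]] := isotropic_h char_R anisotropic UU.
    exists c, (row4 0 0 0 1), (row3 0 0 1); split=> //.
    exact: corresponding_points_infinity.
  exists c, (affine_g a b z), (affine_h a b z); split=> //.
  exact: corresponding_points_affine.
rewrite (herm_transvectionZ hH).
have [n sn ->] := skew_quat char_R (skew_scale hH c tm).
have snN : sigma (- n) = - - n by rewrite sigmaN sn.
exists (herm_transvection (f:=g) v (- n)).
have [tA uA] := herm_transvection_unitary gH vv snN.
by split=> //; rewrite -[n in q n]opprK; exact: vY.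
Qed.

(** Three terms suffice: one for the e0j, one for e12 and e13, one for e23. *)
Lemma wedge_span X : exists x1 y1 x2 y2 x3 y3,
  X = wedge x1 y1 + wedge x2 y2 + wedge x3 y3.
Proof.
have [a [x e0]] := quatP (X 0 0); have [b [y e1]] := quatP (X 0 1).
have [c [z e2]] := quatP (X 0 2).
exists (row4 1 0 0 0), (row4 0 a x b), (row4 0 1 0 0), (row4 0 0 (- y) c).
exists (row4 0 0 1 0), (row4 0 0 0 (- z)).
rewrite (row3P X) e0 e1 e2 /wedge /plucker !row4E !row3D !quatE.
by congr row3; congr quat_of; ring.
Qed.

Lemma wedgeZ c x y : wedge (c *: x) (c *: y) = q (c * c) 0 *: wedge x y.
Proof.
rewrite /wedge /plucker row3Z !quatE !mxE.
by congr row3; congr quat_of; ring.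
Qed.

Lemma wedge_plucker x y x' y' c : wedge x' y' = q c 0 *: wedge x y ->
  forall i j, plucker x' y' i j = c * plucker x y i j.
Proof.
move=> e.
have pA (u v : 'rV[C]_4) i j : plucker u v j i = - plucker u v i j.
  by rewrite /plucker; ring.
have p0 (u v : 'rV[C]_4) i : plucker u v i i = 0 by rewrite /plucker; ring.
pose prop i j := plucker x' y' i j = c * plucker x y i j.
have [[p01 p02] [p03 p12] [p13 p23]] :
    [/\ prop 0 1 /\ prop 0 2, prop 0 3 /\ prop 1 2 & prop 1 3 /\ prop 2 3].
  move: e; rewrite /prop /wedge row3Z !quatE !(mul0r, mulr0, subr0, addr0).
  move=> /rowP e; have := e 0; have := e 1; have := e 2; rewrite !mxE /=.
  move=> /quat_of_inj[-> /eqP e2] /quat_of_inj[-> /eqP e1] /quat_of_inj[-> ->].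
  by move: e1 e2; rewrite !mulrN !eqr_opp => /eqP-> /eqP->.
apply: ord4_ind; apply: ord4_ind; rewrite ?p0 ?mulr0 //.
- by rewrite pA [in RHS]pA p01 mulrN.
- by rewrite pA [in RHS]pA p02 mulrN.
- by rewrite pA [in RHS]pA p12 mulrN.
- by rewrite pA [in RHS]pA p03 mulrN.
- by rewrite pA [in RHS]pA p13 mulrN.
- by rewrite pA [in RHS]pA p23 mulrN.
Qed.

(** If B is multiplication by a central c, which lies in C, then A x ^ A y is
    c (x ^ y) for all y.  Since A x ^ A x ^ A y = 0, also A x ^ x ^ y = 0 for
    all y, and hence A x ^ x = 0. *)
Lemma wedge_homothety
    (A : 'rV[C]_4 -> 'rV[C]_4) (B : 'rV[H]_3 -> 'rV[H]_3) :
  linear A -> linear B -> injective B -> wedge_compatible A B ->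
  (forall v, exists c, A v = c *: v) <-> (forall W, exists c, B W = c *: W).
Proof.
move=> linA linB injB AB; split.
  move=> /(pointwise_homothety linA)[c [_ hA]] W; exists (q (c * c) 0).
  have BD X Y : B (X + Y) = B X + B Y by rewrite -[X]scale1r linB !scale1r.
  have [x1 [y1 [x2 [y2 [x3 [y3 ->]]]]]] := wedge_span W.
  by rewrite !BD !AB !hA !wedgeZ !scalerDr.
move=> /(pointwise_homothety linB)[Q [/quat_center[c ->] hB]] x.
have c0 : c != 0.
  apply/eqP => c0; have /rowP/(_ 0) : (row3 1 0 0 : 'rV[H]_3) = 0.
    by apply: injB; rewrite !hB c0 quat_of0 !scale0r.
  by rewrite !mxE /= => /eqP; rewrite oner_eq0.
have hp y : forall i j, plucker (A x) (A y) i j = c * plucker x y i j.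
  by apply: wedge_plucker; rewrite -AB hB.
have prop i j : A x 0 i * x 0 j = A x 0 j * x 0 i.
  (* For y = e_k, the (i, j, k) coordinate of A x ^ x ^ y is, up to sign, the
     (i, j) coordinate of A x ^ x. *)
  have /card_gt0P[k] : (0 < #|~: [set i; j]|)%N.
    by rewrite cardsCs finset.setCK card_ord cards2; case: (i != j).
  rewrite !inE negb_or => /andP[ki kj].
  pose y : 'rV[C]_4 := delta_mx 0 k.
  have yk : y 0 k = 1 by rewrite mxE !eqxx.
  have yi : y 0 i = 0 by rewrite mxE eq_sym (negbTE ki) andbF.
  have yj : y 0 j = 0 by rewrite mxE eq_sym (negbTE kj) andbF.
  have : A x 0 i * plucker (A x) (A y) j k - A x 0 j * plucker (A x) (A y) i k
     + A x 0 k * plucker (A x) (A y) i j = 0 by rewrite /plucker; ring.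
  rewrite !hp /plucker yk yi yj => e; apply: (mulfI c0); apply/eqP.
  by rewrite -subr_eq0 -[X in _ == X]e; apply/eqP; ring.
have [x0|/rV0Pn[j xj]] := eqVneq x 0.
  by exists 0; rewrite x0 -[in LHS](scale0r 0) linear_smul // !scale0r.
exists (A x 0 j / x 0 j); apply/rowP => i; rewrite mxE.
by apply: (mulIf xj); rewrite prop mulrAC divfK.
Qed.

Lemma wedge_compatible_group : group_relation wedge_compatible.
Proof.
split=> [//|A1 A2 B1 B2 h1 h2 x y|A A' B B' AB _ A'K BK _ x y].
  by rewrite /= h2 h1.
by rewrite -{1}(A'K x) -{1}(A'K y) -AB BK.
Qed.

End ExteriorSquare.

Theorem theorem3p7
    (R : fieldType) (char_R : 2%N \notin [pchar R])
    (C : splittingFieldType R) (dim_C : (\dim {:C})%VS = 2%N)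
    (sigma : gal_of {:C}) (sigma2 : #[sigma]%g = 2%N)
    (gal_C : 'Gal({:C} / 1)%g = <[sigma]>%g)
    (s : R) (s_neq0 : s != 0)
    (anisotropic : forall a b : C, (a, b) <> (0, 0) ->
       a * sigma a + s%:A * b * sigma b != 0) :
  group_isomorphic (PEU (form_g s sigma)) (PEU (form_h s sigma2)).
Proof.
apply: (@PEU_isomorphic _ _ _ _ _ _ (@wedge_compatible R C s sigma sigma2)).
- exact: field_division.
- exact: quat_division.
- exact: wedge_compatible_group.
- exact: transvection_g_to_h.
- exact: transvection_h_to_g.
- by move=> A B linA _ linB injB; exact: wedge_homothety.
Qed.
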